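(* If $\Gamma\vdash_{\mathcal{AF}2S}t:A$ and $t\to_\beta t'$, then $\Gamma\vdash_{\mathcal{AF}2S}t':A$.
   Context: $\lambda$-terms are pure $\lambda$-terms (up to renaming of bound variables); $(t)u$ is application; $\to_\beta$ is many-step $\beta$-reduction. Formulas. Fix a second-order language $L$ (function symbols, predicate symbols) and a set $E$ of equations $t=t'$ between terms of $L$. Formulas (types) are built from atomic formulas ($\perp$, $P(t_1,\ldots,t_n)$ with $P$ an $n$-ary predicate symbol, $X(t_1,\ldots,t_n)$ with $X$ an $n$-ary predicate variable, $n\ge 0$) using $\to$ and $\forall$ over individual (first-order) variables $x$ and predicate (second-order) variables $X$. Formulas are taken up to renaming of bound variables. $A[u/x]$ is substitution of a term; $A[G/X]$ is obtained by replacing each atomic formula $X(t_1,\ldots,t_n)$ of $A$ by $G[t_1/x_1,\ldots,t_n/x_n]$ (for chosen variables $x_1,\ldots,x_n$). A particular case of an equation $t=t'$ is $t[u_1/x_1,\ldots]=t'[u_1/x_1,\ldots]$ or $t'[u_1/x_1,\ldots]=t[u_1/x_1,\ldots]$, with $u_i$ terms. A context $\Gamma$ is a set $x_1:A_1,\ldots,x_n:A_n$ with distinct $\lambda$-variables $x_i$. $\xi$ denotes a first- or second-order variable, $\boldsymbol\xi=\xi_1,\ldots,\xi_n$ a finite (possibly empty) sequence of such variables, $\forall\boldsymbol\xi A=\forall\xi_1\ldots\forall\xi_n A$; $\boldsymbol\xi$ is not free in $\Gamma$ if no $\xi_i$ is free in a formula of $\Gamma$. The relation $A\subseteq B$ on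 formulas is generated by: $(ax')$ $A\subseteq A$; $(dist)$ $\forall\xi(C\to D)\subseteq\forall\xi C\to\forall\xi D$; $(\to)$ if $C'\subseteq C$ and $D\subseteq D'$ then $C\to D\subseteq C'\to D'$; $(\forall_e)$ if $A\subseteq\forall\xi C$ then $A\subseteq C[F/\xi]$ ($F$ a term if $\xi$ is first-order, a formula if $\xi$ is second-order); $(\forall_i)$ if $A\subseteq D$ and $\xi$ is not free in $A$ then $A\subseteq\forall\xi D$; $(tr)$ if $A\subseteq D$ and $D\subseteq B$ then $A\subseteq B$; $(e)$ if $A\subseteq D[u/y]$ and $u=v$ is a particular case of an equation of $E$ then $A\subseteq D[v/y]$. System $\mathcal{AF}2S$ (with $\boldsymbol\xi$ not free in $\Gamma$ in each rule): (S1) if $x:B\in\Gamma$ and $\forall\boldsymbol\xi B\subseteq A$ then $\Gamma\vdash x:A$; (S2) if $\Gamma,x:B\vdash u:C$ and $\forall\boldsymbol\xi(B\to C)\subseteq A$ then $\Gamma\vdash\lambda xu:A$; (S3) if $\Gamma\vdash u:B\to C$, $\Gamma\vdash v:B$ and $\forall\boldsymbol\xi C\subseteq A$ then $\Gamma\vdash(u)v:A$. *)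

(* Defs.v *)
From Stdlib Require Vector.
From Stdlib Require Import Arith List Relations.
Import ListNotations.

Set Implicit Arguments.

(** Pure lambda-terms and formulas, both up to renaming of bound variables, are
    encoded with de Bruijn indices: lambda-terms with one family of indices,
    formulas with one family for individual variables and, for each arity [n],
    one family for the predicate variables of arity [n]. *)

Inductive lam : Type :=
| LVar (x : nat)
| LApp (t u : lam)
| LAbs (t : lam).

Definition scons {T : Type} (a : T) (s : nat -> T) (i : nat) : T :=
  match i with 0 => a | S j => s j end.

Fixpoint lren (r : nat -> nat) (t : lam) : lam :=
  match t with
  | LVar x => LVar (r x)
  | LApp t u => LApp (lren r t) (lren r u)
  | LAbs t => LAbs (lren (scons 0 (fun i => S (r i))) t)
  end.

Fixpoint lsubst (s : nat -> lam) (t : lam) : lam :=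
  match t with
  | LVar x => s x
  | LApp t u => LApp (lsubst s t) (lsubst s u)
  | LAbs t => LAbs (lsubst (scons (LVar 0) (fun i => lren S (s i))) t)
  end.

Inductive beta1 : lam -> lam -> Prop :=
| beta1_redex t u : beta1 (LApp (LAbs t) u) (lsubst (scons u LVar) t)
| beta1_appl t t' u : beta1 t t' -> beta1 (LApp t u) (LApp t' u)
| beta1_appr t u u' : beta1 u u' -> beta1 (LApp t u) (LApp t u')
| beta1_abs t t' : beta1 t t' -> beta1 (LAbs t) (LAbs t').

Definition beta : lam -> lam -> Prop := clos_refl_trans lam beta1.

Record language : Type := Language {
  fsym : Type;
  farity : fsym -> nat;
  psym : Type;
  parity : psym -> nat
}.

Inductive term (L : language) : Type :=
| Var (x : nat)
| Fn (f : fsym L) (ts : Vector.t (term L) (farity L f)).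

Arguments Var {L} x.
Arguments Fn {L} f ts.

(** The sort of a variable [xi]: individual, or predicate of a given arity. *)
Inductive sort : Type :=
| Ind
| Pred (n : nat).

(** [PVar n X ts] is the [X]-th predicate variable of arity [n] applied to
    [ts].  [All Ind] binds the individual variable [0] and [All (Pred n)] the
    predicate variable [0] of arity [n]; the latter does not affect the indices
    of predicate variables of other arities. *)
Inductive form (L : language) : Type :=
| Bot
| PSym (P : psym L) (ts : Vector.t (term L) (parity L P))
| PVar (n : nat) (X : nat) (ts : Vector.t (term L) n)
| Imp (A B : form L)
| All (k : sort) (A : form L).

Arguments Bot {L}.
Arguments PSym {L} P ts.
Arguments PVar {L} n X ts.
Arguments Imp {L} A B.
Arguments All {L} k A.

Fixpoint tsubst {L : language} (s : nat -> term L) (t : term L) : term L :=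
  match t with
  | Var x => s x
  | Fn f ts => Fn f (Vector.map (tsubst s) ts)
  end.

Definition tshift {L : language} : nat -> term L := fun i => Var (S i).

Definition up_ind {L : language} (k : sort) (s : nat -> term L) :
    nat -> term L :=
  match k with
  | Ind => scons (Var 0) (fun i => tsubst tshift (s i))
  | Pred _ => s
  end.

Fixpoint fsubst {L : language} (s : nat -> term L) (A : form L) : form L :=
  match A with
  | Bot => Bot
  | PSym P ts => PSym P (Vector.map (tsubst s) ts)
  | PVar n X ts => PVar n X (Vector.map (tsubst s) ts)
  | Imp A B => Imp (fsubst s A) (fsubst s B)
  | All k A => All k (fsubst (up_ind k s) A)
  end.

(** A renaming [r] sends the variable [X] of arity [n] to the variable [r n X]
    of the same arity. *)
Definition up_ren (k : sort) (r : nat -> nat -> nat) : nat -> nat -> nat :=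
  match k with
  | Ind => r
  | Pred n => fun m =>
      if Nat.eq_dec m n then scons 0 (fun X => S (r m X)) else r m
  end.

Fixpoint fren {L : language} (r : nat -> nat -> nat) (A : form L) : form L :=
  match A with
  | Bot => Bot
  | PSym P ts => PSym P ts
  | PVar n X ts => PVar n (r n X) ts
  | Imp A B => Imp (fren r A) (fren r B)
  | All k A => All k (fren (up_ren k r) A)
  end.

(** [lift k A] is [A] regarded as a formula in which a fresh variable of sort
    [k] has index [0].  Being in the image of [lift k] is how "[xi] is not free
    in [A]" is expressed below. *)
Definition lift {L : language} (k : sort) (A : form L) : form L :=
  match k with
  | Ind => fsubst tshift A
  | Pred n => fren (fun m X => if Nat.eq_dec m n then S X else X) A
  end.

(** A formula [G] to be substituted for a variable of arity [n] has its chosen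
    variables [x_1, ..., x_n] as indices [0, ..., n-1]; its other free
    individual variables have their index increased by [n].  Hence
    [papply G ts] is [G[t_1/x_1, ..., t_n/x_n]]. *)
Fixpoint vscons {L : language} {n : nat} (ts : Vector.t (term L) n)
    (s : nat -> term L) : nat -> term L :=
  match ts with
  | Vector.nil _ => s
  | Vector.cons _ t _ ts' => scons t (vscons ts' s)
  end.

Definition papply {L : language} {n : nat} (G : form L)
    (ts : Vector.t (term L) n) : form L :=
  fsubst (vscons ts Var) G.

Fixpoint vars_from {L : language} (i n : nat) : Vector.t (term L) n :=
  match n with
  | 0 => Vector.nil _
  | S m => Vector.cons _ (Var i) m (vars_from (S i) m)
  end.

(** The formula [X(x_1, ..., x_n)] with chosen variables [x_1, ..., x_n]. *)
Definition pvar {L : language} (n X : nat) : form L := PVar n X (vars_from 0 n).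

(** [th n X] is the formula, with [n] chosen variables, substituted for the
    predicate variable [X] of arity [n].  Below an individual quantifier, only
    its non-chosen variables are shifted. *)
Definition up_pred {L : language} (k : sort) (th : nat -> nat -> form L) :
    nat -> nat -> form L :=
  match k with
  | Ind => fun m X =>
      fsubst (fun i => Var (if i <? m then i else S i)) (th m X)
  | Pred n => fun m =>
      if Nat.eq_dec m n
      then scons (pvar m 0) (fun X => lift (Pred n) (th m X))
      else fun X => lift (Pred n) (th m X)
  end.

Fixpoint psubst {L : language} (th : nat -> nat -> form L) (A : form L) :
    form L :=
  match A with
  | Bot => Bot
  | PSym P ts => PSym P ts
  | PVar n X ts => papply (th n X) ts
  | Imp A B => Imp (psubst th A) (psubst th B)
  | All k A => All k (psubst (up_pred k th) A)
  end.

(** [C[u/x]] and [C[G/X]] for the variable bound by [All Ind C], respectively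
    [All (Pred n) C]. *)
Definition inst_ind {L : language} (C : form L) (u : term L) : form L :=
  fsubst (scons u Var) C.

Definition inst_pred {L : language} (n : nat) (C G : form L) : form L :=
  psubst (fun m => if Nat.eq_dec m n then scons G (pvar m) else pvar m) C.

Inductive particular_case {L : language} (E : term L -> term L -> Prop) :
    term L -> term L -> Prop :=
| particular_lr t t' s : E t t' -> particular_case E (tsubst s t) (tsubst s t')
| particular_rl t t' s : E t t' -> particular_case E (tsubst s t') (tsubst s t).

Inductive fincl {L : language} (E : term L -> term L -> Prop) :
    form L -> form L -> Prop :=
| fincl_ax A : fincl E A A
| fincl_dist k C D : fincl E (All k (Imp C D)) (Imp (All k C) (All k D))
| fincl_imp C C' D D' :
    fincl E C' C -> fincl E D D' -> fincl E (Imp C D) (Imp C' D')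
| fincl_all_e_ind A C u :
    fincl E A (All Ind C) -> fincl E A (inst_ind C u)
| fincl_all_e_pred A n C G :
    fincl E A (All (Pred n) C) -> fincl E A (inst_pred n C G)
| fincl_all_i A k D : fincl E (lift k A) D -> fincl E A (All k D)
| fincl_tr A D B : fincl E A D -> fincl E D B -> fincl E A B
| fincl_eq A D u v :
    fincl E A (inst_ind D u) -> particular_case E u v ->
    fincl E A (inst_ind D v).

(** The lambda-variable of index [x] is declared with the [x]-th formula of the
    list. *)
Definition context (L : language) : Type := list (form L).

Definition alls {L : language} (ks : list sort) (A : form L) : form L :=
  fold_right All A ks.

Definition lifts {L : language} (ks : list sort) (A : form L) : form L :=
  fold_left (fun B k => lift k B) ks A.

(** [ks] lists the sorts of [xi_1, ..., xi_n].  In each rule the premises live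
    in the scope extended by these variables, and the context there is
    [map (lifts ks) Gamma]: the [xi_i] are not free in it. *)
Inductive typing {L : language} (E : term L -> term L -> Prop) :
    context L -> lam -> form L -> Prop :=
| typing_var Gamma ks x B A :
    nth_error (map (lifts ks) Gamma) x = Some B ->
    fincl E (alls ks B) A ->
    typing E Gamma (LVar x) A
| typing_abs Gamma ks u B C A :
    typing E (B :: map (lifts ks) Gamma) u C ->
    fincl E (alls ks (Imp B C)) A ->
    typing E Gamma (LAbs u) A
| typing_app Gamma ks u v B C A :
    typing E (map (lifts ks) Gamma) u (Imp B C) ->
    typing E (map (lifts ks) Gamma) v B ->
    fincl E (alls ks C) A ->
    typing E Gamma (LApp u v) A.

(* Main.v *)
(** The proof rests on an inversion of inclusion that survives transitivity: if
    [forall xi (B -> C)] is included in [A'], then [A'] has the form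
    [forall xi' (B' -> C')], and there are fresh variables [zeta] and a
    substitution [sigma] for [xi] such that [B'] is included in [B sigma] and
    [forall zeta (C sigma)] in [C'].  If [\x u] has type [B' -> C'] because [u]
    has type [C] under [x : B], then applying [sigma] to that derivation,
    substituting the argument for [x] and generalizing over [zeta] types the
    contracted redex.

    Individual and predicate variables are substituted simultaneously, as
    [psubst th (fsubst s A)]; this form is closed under composition because
    [fsubst] can be moved inside [psubst]. *)

From Stdlib Require Import Arith List Lia FunctionalExtensionality.
From Stdlib Require Vector.
Require Import Defs.
Import ListNotations.

Set Implicit Arguments.

(** * Individual substitutions and renamings of predicate variables *)

(** The generated induction principle gives no hypothesis for the subterms stored in the argument
    vector. *)
Lemma term_nested_ind (L : language) (P : term L -> Prop) :
  (forall x, P (Var x)) ->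
  (forall f ts, (forall t, Vector.In t ts -> P t) -> P (Fn f ts)) ->
  forall t, P t.
Proof.
  intros HV HF; fix IH 1; intros [x | f ts]; [apply HV | apply HF].
  induction ts as [| u n us IHts]; intros t Ht.
  - inversion Ht.
  - pose proof (IH u) as Hu.
    apply Vector.In_cons_iff in Ht as [<- | Ht]; [exact Hu | exact (IHts t Ht)].
Qed.

Lemma tsubst_Var (L : language) (t : term L) : tsubst Var t = t.
Proof.
  induction t as [x | f ts IH] using term_nested_ind; simpl; [reflexivity|].
  f_equal; rewrite <- (Vector.map_id _ _ ts) at 2.
  apply Vector.map_ext_in; exact IH.
Qed.

Lemma tsubst_comp (L : language) (s s' : nat -> term L) t :
  tsubst s' (tsubst s t) = tsubst (fun i => tsubst s' (s i)) t.
Proof.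
  induction t as [x | f ts IH] using term_nested_ind; simpl; [reflexivity|].
  f_equal; rewrite Vector.map_map; apply Vector.map_ext_in; exact IH.
Qed.

Lemma map_tsubst_Var (L : language) n (ts : Vector.t (term L) n) :
  Vector.map (tsubst Var) ts = ts.
Proof.
  rewrite <- (Vector.map_id _ _ ts) at 2.
  apply Vector.map_ext; intros t; apply tsubst_Var.
Qed.

Lemma map_tsubst_comp (L : language) (s s' : nat -> term L) n
    (ts : Vector.t (term L) n) :
  Vector.map (tsubst s') (Vector.map (tsubst s) ts)
  = Vector.map (tsubst (fun i => tsubst s' (s i))) ts.
Proof.
  rewrite Vector.map_map; apply Vector.map_ext; intros t; apply tsubst_comp.
Qed.

Lemma up_ind_Var (L : language) k : up_ind k (@Var L) = Var.
Proof.
  destruct k; [|reflexivity]; extensionality i; destruct i; reflexivity.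
Qed.

Lemma up_ind_comp (L : language) k (s s' : nat -> term L) :
  up_ind k (fun i => tsubst s' (s i))
  = fun i => tsubst (up_ind k s') (up_ind k s i).
Proof.
  destruct k; [|reflexivity].
  extensionality i; destruct i as [|i]; [reflexivity|]; simpl.
  now rewrite !tsubst_comp.
Qed.

Lemma fsubst_Var (L : language) (A : form L) : fsubst Var A = A.
Proof.
  induction A; simpl; rewrite ?map_tsubst_Var, ?up_ind_Var; f_equal; auto.
Qed.

Lemma fsubst_comp (L : language) (A : form L) (s s' : nat -> term L) :
  fsubst s' (fsubst s A) = fsubst (fun i => tsubst s' (s i)) A.
Proof.
  revert s s'; induction A; intros s s'; simpl;
    rewrite ?map_tsubst_comp, ?(up_ind_comp k s s'); f_equal; auto.
Qed.

Lemma fsubst_fren (L : language) (A : form L) (s : nat -> term L) r :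
  fsubst s (fren r A) = fren r (fsubst s A).
Proof. revert s r; induction A; intros s r; simpl; f_equal; auto. Qed.

Lemma up_ren_comp k (r r' : nat -> nat -> nat) :
  up_ren k (fun m X => r' m (r m X))
  = fun m X => up_ren k r' m (up_ren k r m X).
Proof.
  destruct k; [reflexivity|]; extensionality m; extensionality X; simpl.
  destruct (Nat.eq_dec m n); [|reflexivity]; destruct X; reflexivity.
Qed.

Lemma fren_comp (L : language) (A : form L) (r r' : nat -> nat -> nat) :
  fren r' (fren r A) = fren (fun m X => r' m (r m X)) A.
Proof.
  revert r r'; induction A; intros r r'; simpl; try rewrite (up_ren_comp k r r');
    f_equal; auto.
Qed.

(** ** Individual substitutions under several binders *)

Local Arguments Nat.sub : simpl never.
Local Arguments Nat.ltb : simpl never.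

Ltac case_ltb :=
  repeat (match goal with
          | |- context [?a <? ?b] => destruct (Nat.ltb_spec a b)
          end; simpl; try lia).

(** Makes room for [n] individual variables just above [m] chosen ones; [up_pred Ind] uses the case
    of a single new variable. *)
Definition shift_above {L : language} (m n : nat) : nat -> term L :=
  fun i => Var (if i <? m then i else n + i).

(** The [n]-fold iterate of [up_ind Ind], in closed form so that index comparisons reduce to
    arithmetic. It carries [s] past the [n] chosen variables of a formula. *)
Definition upn {L : language} (n : nat) (s : nat -> term L) : nat -> term L :=
  fun i => if i <? n then Var i
           else tsubst (fun j => Var (n + j)) (s (i - n)).

(** The [n]-fold iterate of [up_pred Ind], needed when the target formula itself has [n] chosen
    variables. *)
Definition pshift {L : language} (n : nat) (th : nat -> nat -> form L) :
    nat -> nat -> form L :=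
  fun m X => fsubst (shift_above m n) (th m X).

(** The tails [s0] and [s1] may differ, since an index below [n] never reaches them. *)
Lemma vscons_lt (L : language) n (ts : Vector.t (term L) n) s s0 s1 i :
  i < n ->
  tsubst s (vscons ts s0 i) = vscons (Vector.map (tsubst s) ts) s1 i.
Proof.
  revert i; induction ts as [| t n ts IH]; intros i Hi; [lia|].
  destruct i as [|i]; simpl; [reflexivity | apply IH; lia].
Qed.

Lemma vscons_ge (L : language) n (ts : Vector.t (term L) n) s i :
  n <= i -> vscons ts s i = s (i - n).
Proof.
  revert i; induction ts as [| t n ts IH]; intros i Hi; simpl.
  - now rewrite Nat.sub_0_r.
  - destruct i as [|i]; [lia|]; simpl; apply IH; lia.
Qed.

Lemma map_vars_from (L : language) n (ts : Vector.t (term L) n) s s0 i :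
  (forall j, j < n -> s (i + j) = vscons ts s0 j) ->
  Vector.map (tsubst s) (vars_from i n) = ts.
Proof.
  revert i; induction ts as [| t n ts IH]; intros i H; simpl; [reflexivity|].
  f_equal.
  - rewrite <- (Nat.add_0_r i); apply (H 0); lia.
  - apply IH; intros j Hj; replace (S i + j) with (i + S j) by lia.
    apply (H (S j)); lia.
Qed.

Lemma map_vars_from_id (L : language) n (s : nat -> term L) i :
  (forall j, j < n -> s (i + j) = Var (i + j)) ->
  Vector.map (tsubst s) (vars_from i n) = vars_from i n.
Proof.
  revert i; induction n as [| n IH]; intros i H; simpl; [reflexivity|].
  f_equal.
  - rewrite <- (Nat.add_0_r i); apply (H 0); lia.
  - apply IH; intros j Hj; replace (S i + j) with (i + S j) by lia.
    apply H; lia.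
Qed.

Lemma fsubst_pvar (L : language) n X (s : nat -> term L) :
  (forall j, j < n -> s j = Var j) -> fsubst s (pvar n X) = pvar n X.
Proof.
  intros H; unfold pvar; simpl; f_equal; apply map_vars_from_id.
  intros j Hj; now apply H.
Qed.

Lemma papply_pvar (L : language) n X (ts : Vector.t (term L) n) :
  papply (pvar n X) ts = PVar n X ts.
Proof.
  unfold papply, pvar; simpl; f_equal; eapply map_vars_from.
  intros j _; reflexivity.
Qed.

Lemma fsubst_papply (L : language) n (G : form L) (ts : Vector.t (term L) n) s :
  fsubst s (papply G ts)
  = papply (fsubst (upn n s) G) (Vector.map (tsubst s) ts).
Proof.
  unfold papply; rewrite !fsubst_comp; f_equal.
  extensionality i; unfold upn; destruct (Nat.ltb_spec i n); simpl.
  - now apply vscons_lt.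
  - rewrite vscons_ge by lia; rewrite tsubst_comp; simpl.
    rewrite <- (tsubst_Var (s (i - n))) at 1; f_equal.
    extensionality j; rewrite vscons_ge by lia; f_equal; lia.
Qed.

(** ** Commutation of the substitution operations *)

Lemma fsubst_lift_Pred (L : language) n (A : form L) s :
  fsubst s (lift (Pred n) A) = lift (Pred n) (fsubst s A).
Proof. apply fsubst_fren. Qed.

Lemma up_pred_fsubst (L : language) k (th : nat -> nat -> form L) s :
  up_pred k (fun m X => fsubst (upn m s) (th m X))
  = fun m X => fsubst (upn m (up_ind k s)) (up_pred k th m X).
Proof.
  extensionality m; extensionality X; destruct k as [| n].
  - unfold up_pred; rewrite !fsubst_comp; f_equal; extensionality i.
    unfold upn; simpl. case_ltb; try reflexivity.
    replace (S i - m) with (S (i - m)) by lia; simpl.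
    rewrite !tsubst_comp; f_equal; extensionality j; unfold tshift; simpl.
    case_ltb; f_equal; lia.
  - unfold up_pred; destruct (Nat.eq_dec m n) as [-> |].
    + destruct X as [|X]; cbn [scons].
      * rewrite fsubst_pvar; [reflexivity|].
        intros j Hj; unfold upn; case_ltb; reflexivity.
      * now rewrite fsubst_lift_Pred.
    + now rewrite fsubst_lift_Pred.
Qed.

(** Each inserted formula is hit by [s] below its own chosen variables, hence [upn m s]. This
    exchange is what lets a composite return to the form of [app]. *)
Lemma fsubst_psubst (L : language) (A : form L) (th : nat -> nat -> form L) s :
  fsubst s (psubst th A)
  = psubst (fun m X => fsubst (upn m s) (th m X)) (fsubst s A).
Proof.
  revert th s; induction A; intros th s; simpl;
    try rewrite (up_pred_fsubst k th s); rewrite ?fsubst_papply;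
    f_equal; auto.
Qed.

Lemma up_pred_ren (L : language) k (th : nat -> nat -> form L) r :
  up_pred k (fun m X => th m (r m X))
  = fun m X => up_pred k th m (up_ren k r m X).
Proof.
  extensionality m; extensionality X; destruct k as [| n]; [reflexivity|].
  simpl; destruct (Nat.eq_dec m n); [|reflexivity]; destruct X; reflexivity.
Qed.

Lemma psubst_fren (L : language) (A : form L) (th : nat -> nat -> form L) r :
  psubst th (fren r A) = psubst (fun m X => th m (r m X)) A.
Proof.
  revert th r; induction A; intros th r; simpl; try rewrite (up_pred_ren k th r);
    f_equal; auto.
Qed.

Lemma up_pred_fren (L : language) k (th : nat -> nat -> form L) r :
  up_pred k (fun m X => fren r (th m X))
  = fun m X => fren (up_ren k r) (up_pred k th m X).
Proof.
  extensionality m; extensionality X; destruct k as [| n].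
  - apply fsubst_fren.
  - assert (H : forall B : form L,
      lift (Pred n) (fren r B) = fren (up_ren (Pred n) r) (lift (Pred n) B)).
    { intros B; unfold lift; rewrite !fren_comp; f_equal.
      extensionality p; extensionality Y; simpl.
      destruct (Nat.eq_dec p n); reflexivity. }
    unfold up_pred; destruct (Nat.eq_dec m n) as [-> |]; [|apply H].
    destruct X as [|X]; cbn [scons]; [|apply H].
    unfold pvar; simpl; now destruct (Nat.eq_dec n n).
Qed.

Lemma fren_psubst (L : language) (A : form L) (th : nat -> nat -> form L) r :
  fren r (psubst th A) = psubst (fun m X => fren r (th m X)) A.
Proof.
  revert th r; induction A; intros th r; simpl; try rewrite (up_pred_fren k th r);
    unfold papply; rewrite ?fsubst_fren;
    f_equal; auto.
Qed.

Lemma up_pred_pvar (L : language) k : up_pred k (@pvar L) = pvar.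
Proof.
  extensionality m; extensionality X; destruct k as [| n].
  - apply fsubst_pvar; intros j Hj; case_ltb; reflexivity.
  - simpl; destruct (Nat.eq_dec m n) as [-> |].
    + destruct X; [reflexivity|]; unfold pvar; simpl.
      now destruct (Nat.eq_dec n n).
    + unfold pvar; simpl; now destruct (Nat.eq_dec m n).
Qed.

Lemma psubst_pvar (L : language) (A : form L) : psubst pvar A = A.
Proof.
  induction A; simpl; rewrite ?papply_pvar, ?up_pred_pvar;
    f_equal; auto.
Qed.

Lemma fren_psubst_pvar (L : language) (A : form L) r :
  fren r A = psubst (fun m X => pvar m (r m X)) A.
Proof. now rewrite <- (psubst_pvar (fren r A)), psubst_fren. Qed.

(** Inside [G] the indices below [n] are chosen variables, which the formulas of [th] must avoid.
    Instantiating by [ts] undoes the shift, so this is an instance of [fsubst_psubst]. *)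
Lemma psubst_papply (L : language) (th : nat -> nat -> form L) n (G : form L)
    (ts : Vector.t (term L) n) :
  psubst th (papply G ts) = papply (psubst (pshift n th) G) ts.
Proof.
  unfold papply; rewrite fsubst_psubst; f_equal.
  extensionality m; extensionality X; unfold pshift; rewrite fsubst_comp.
  rewrite <- (fsubst_Var (th m X)) at 1; f_equal; extensionality i.
  unfold shift_above, upn; simpl; case_ltb; try reflexivity.
  rewrite vscons_ge by lia; simpl; f_equal; lia.
Qed.

(** A bound individual variable lies just above the [n] chosen ones, so room for it is made at index
    [n]. The individual case is shaped so that [fsubst_psubst] applies to it in [up_pred_comp]. *)
Lemma pshift_up_pred (L : language) k (th : nat -> nat -> form L) n :
  pshift n (up_pred k th)
  = match k with
    | Ind => fun m X => fsubst (upn m (shift_above n 1)) (pshift n th m X)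
    | Pred p => up_pred (Pred p) (pshift n th)
    end.
Proof.
  extensionality m; extensionality X; unfold pshift; destruct k as [| p].
  - unfold up_pred; rewrite !fsubst_comp; f_equal; extensionality i.
    unfold shift_above, upn; simpl; case_ltb; f_equal; lia.
  - unfold up_pred; destruct (Nat.eq_dec m p) as [-> |].
    + destruct X as [|X]; cbn [scons].
      * apply fsubst_pvar; intros j Hj; unfold shift_above; case_ltb.
        reflexivity.
      * apply fsubst_lift_Pred.
    + apply fsubst_lift_Pred.
Qed.

Lemma up_pred_comp (L : language) k (th th' : nat -> nat -> form L) :
  up_pred k (fun m X => psubst (pshift m th') (th m X))
  = fun m X => psubst (pshift m (up_pred k th')) (up_pred k th m X).
Proof.
  extensionality m; extensionality X; rewrite pshift_up_pred.
  destruct k as [| n].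
  - apply fsubst_psubst.
  - assert (H : forall B : form L,
      lift (Pred n) (psubst (pshift m th') B)
      = psubst (up_pred (Pred n) (pshift m th')) (lift (Pred n) B)).
    { intros B; unfold lift; rewrite psubst_fren, fren_psubst; f_equal.
      extensionality p; extensionality Y; simpl.
      destruct (Nat.eq_dec p n); reflexivity. }
    unfold up_pred at 1 3; destruct (Nat.eq_dec m n) as [-> |]; [|apply H].
    destruct X as [|X]; cbn [scons]; [|apply H].
    unfold pvar at 2; simpl; destruct (Nat.eq_dec n n); [|easy].
    symmetry; apply papply_pvar.
Qed.

Lemma psubst_comp (L : language) (A : form L) (th th' : nat -> nat -> form L) :
  psubst th' (psubst th A)
  = psubst (fun m X => psubst (pshift m th') (th m X)) A.
Proof.
  revert th th'; induction A; intros th th'; simpl;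
    try rewrite (up_pred_comp k th th'); rewrite ?psubst_papply;
    f_equal; auto.
Qed.

(** ** Simultaneous substitutions *)

Record subst (L : language) : Type := Subst {
  sub_ind : nat -> term L;
  sub_pred : nat -> nat -> form L
}.

Definition app {L : language} (sg : subst L) (A : form L) : form L :=
  psubst (sub_pred sg) (fsubst (sub_ind sg) A).

(** A formula inserted by [sg] undergoes all of [tau], with its [m] chosen variables protected. *)
Definition comp {L : language} (sg tau : subst L) : subst L :=
  Subst (fun i => tsubst (sub_ind tau) (sub_ind sg i))
    (fun m X => psubst (pshift m (sub_pred tau))
                  (fsubst (upn m (sub_ind tau)) (sub_pred sg m X))).

Definition up {L : language} (k : sort) (sg : subst L) : subst L :=
  Subst (up_ind k (sub_ind sg)) (up_pred k (sub_pred sg)).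

Definition ups {L : language} (ks : list sort) (sg : subst L) : subst L :=
  fold_left (fun tau k => up k tau) ks sg.

Definition idsub {L : language} : subst L := Subst Var pvar.

Definition wk {L : language} (k : sort) : subst L :=
  match k with
  | Ind => Subst tshift pvar
  | Pred n =>
      Subst Var (fun m X => pvar m (if Nat.eq_dec m n then S X else X))
  end.

Definition sub1_ind {L : language} (u : term L) : subst L :=
  Subst (scons u Var) pvar.

Definition sub1_pred {L : language} (n : nat) (G : form L) : subst L :=
  Subst Var (fun m => if Nat.eq_dec m n then scons G (pvar m) else pvar m).

Lemma app_comp (L : language) (sg tau : subst L) A :
  app tau (app sg A) = app (comp sg tau) A.
Proof.
  unfold app; rewrite fsubst_psubst, psubst_comp, fsubst_comp; reflexivity.
Qed.

Lemma app_idsub (L : language) (A : form L) : app idsub A = A.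
Proof. unfold app; simpl; now rewrite fsubst_Var, psubst_pvar. Qed.

Lemma app_wk (L : language) k (A : form L) : app (wk k) A = lift k A.
Proof.
  destruct k; unfold app; simpl.
  - apply psubst_pvar.
  - now rewrite fsubst_Var, fren_psubst_pvar.
Qed.

Lemma app_sub1_ind (L : language) (u : term L) A :
  app (sub1_ind u) A = inst_ind A u.
Proof. apply psubst_pvar. Qed.

Lemma app_sub1_pred (L : language) n (G : form L) A :
  app (sub1_pred n G) A = inst_pred n A G.
Proof. unfold app; simpl; now rewrite fsubst_Var. Qed.

Lemma subst_eq (L : language) (sg tau : subst L) :
  (forall i, sub_ind sg i = sub_ind tau i) ->
  (forall m X, sub_pred sg m X = sub_pred tau m X) -> sg = tau.
Proof.
  destruct sg as [s th], tau as [s' th']; simpl; intros H H'.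
  f_equal; [|extensionality m]; extensionality i; auto.
Qed.

Lemma pshift_pvar (L : language) n : pshift n (@pvar L) = pvar.
Proof.
  extensionality m; extensionality X; apply fsubst_pvar; intros j Hj.
  unfold shift_above; case_ltb; reflexivity.
Qed.

Lemma upn_Var (L : language) n : upn n (@Var L) = Var.
Proof.
  extensionality i; unfold upn; simpl; case_ltb; [reflexivity|].
  f_equal; lia.
Qed.

Lemma vscons_vars_from (L : language) k n (s : nat -> term L) i :
  i < n -> vscons (vars_from k n) s i = Var (k + i).
Proof.
  revert k i; induction n as [| n IH]; intros k i Hi; [lia|].
  destruct i as [|i]; simpl; [now rewrite Nat.add_0_r|].
  rewrite IH by lia; f_equal; lia.
Qed.

(** A unit law: applying the shifted formula to its own chosen variables cancels the shift. *)
Lemma psubst_pshift_pvar (L : language) (th : nat -> nat -> form L) m X :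
  psubst (pshift m th) (pvar m X) = th m X.
Proof.
  unfold pvar; simpl; unfold papply, pshift; rewrite fsubst_comp.
  rewrite <- (fsubst_Var (th m X)) at 2; f_equal; extensionality i.
  unfold shift_above; simpl; case_ltb.
  - now rewrite vscons_vars_from.
  - rewrite vscons_ge by lia; f_equal; lia.
Qed.

Lemma comp_pvar (L : language) (sg : subst L) m X :
  psubst (pshift m (sub_pred sg)) (fsubst (upn m (sub_ind sg)) (pvar m X))
  = sub_pred sg m X.
Proof.
  rewrite fsubst_pvar; [apply psubst_pshift_pvar|].
  intros j Hj; unfold upn; case_ltb; reflexivity.
Qed.

Lemma app_up_lift (L : language) k (sg : subst L) A :
  app (up k sg) (lift k A) = lift k (app sg A).
Proof.
  unfold app; destruct k as [| n]; simpl.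
  - rewrite fsubst_psubst, !fsubst_comp; f_equal.
    extensionality m; extensionality X; f_equal; extensionality i.
    unfold upn, tshift; simpl; case_ltb; f_equal; lia.
  - rewrite fsubst_fren, psubst_fren, fren_psubst; f_equal.
    extensionality m; extensionality X.
    destruct (Nat.eq_dec m n); reflexivity.
Qed.

(** Gathers the substitutions of the two elimination rules, so that both sorts of quantifier are
    treated at once. *)
Inductive instance {L : language} : sort -> subst L -> Prop :=
| instance_term u : instance Ind (sub1_ind u)
| instance_form n G : instance (Pred n) (sub1_pred n G).

Lemma instance_lift (L : language) k (io : subst L) A :
  instance k io -> app io (lift k A) = A.
Proof.
  intros [u | n G]; unfold app; simpl.
  - rewrite psubst_pvar, fsubst_comp; apply fsubst_Var.
  - rewrite fsubst_Var, psubst_fren; rewrite <- (psubst_pvar A) at 2; f_equal.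
    extensionality m; extensionality X.
    destruct (Nat.eq_dec m n); reflexivity.
Qed.

Lemma app_inst_ind (L : language) (sg : subst L) C u :
  app sg (inst_ind C u)
  = inst_ind (app (up Ind sg) C) (tsubst (sub_ind sg) u).
Proof.
  rewrite <- !app_sub1_ind, !app_comp; f_equal; apply subst_eq;
      cbn [comp up wk idsub sub1_ind sub1_pred sub_ind sub_pred up_ind up_pred].
  - intros [|i]; simpl; [reflexivity|].
    rewrite tsubst_comp; simpl; symmetry; apply tsubst_Var.
  - intros m X; rewrite comp_pvar, pshift_pvar, psubst_pvar, fsubst_comp.
    rewrite <- (fsubst_Var (sub_pred sg m X)) at 1; f_equal.
    extensionality i; unfold upn; simpl; case_ltb; try reflexivity.
    replace (S i - m) with (S (i - m)) by lia; simpl; f_equal; lia.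
Qed.

Lemma instance_app (L : language) k (io sg : subst L) :
  instance k io ->
  exists io', instance k io' /\
    forall A, app sg (app io A) = app io' (app (up k sg) A).
Proof.
  intros [u | n G].
  - exists (sub1_ind (tsubst (sub_ind sg) u)); split; [constructor|].
    intros A; rewrite !app_sub1_ind; apply app_inst_ind.
  (* The new instance is the image of [G] under [sg], with the [n] chosen variables of [G] left
     fixed. *)
  - exists (sub1_pred n (psubst (pshift n (sub_pred sg))
                           (fsubst (upn n (sub_ind sg)) G))).
    split; [constructor|].
    intros A; rewrite !app_comp; f_equal; apply subst_eq;
      cbn [comp up wk idsub sub1_ind sub1_pred sub_ind sub_pred up_ind up_pred].
    + intros i; symmetry; apply tsubst_Var.
    + intros m X; rewrite upn_Var, fsubst_Var.
      (* The instantiated variable does not occur in a lifted formula, so instantiation merely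
         undoes the lifting. *)
      assert (H : forall m' (B D : form L),
        psubst (pshift m' (sub_pred (sub1_pred n B))) (lift (Pred n) D) = D).
      { intros m' B D; simpl; rewrite psubst_fren.
        transitivity (psubst (pshift m' pvar) D);
          [|rewrite pshift_pvar; apply psubst_pvar].
        f_equal; extensionality p; extensionality Y; unfold pshift.
        destruct (Nat.eq_dec p n); reflexivity. }
      destruct (Nat.eq_dec m n) as [-> |].
      * destruct X as [|X]; cbn [scons].
        -- rewrite psubst_pshift_pvar; destruct (Nat.eq_dec n n); easy.
        -- rewrite comp_pvar; symmetry; apply H.
      * rewrite comp_pvar; symmetry; apply H.
Qed.

(** Instantiating a bound variable by itself: after weakening, the variable in question has index
    0. *)
Lemma instance_zero (L : language) k :
  exists io, @instance L k io /\ forall A, app io (app (up k (wk k)) A) = A.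
Proof.
  destruct k as [| n].
  - exists (sub1_ind (Var 0)); split; [constructor|].
    intros A; rewrite app_comp; rewrite <- (app_idsub A) at 2; f_equal.
    apply subst_eq;
      cbn [comp up wk idsub sub1_ind sub1_pred sub_ind sub_pred up_ind up_pred].
    + intros [|i]; reflexivity.
    + intros m X; rewrite pshift_pvar, psubst_pvar, !fsubst_pvar;
        [reflexivity | |]; intros j Hj; unfold upn; case_ltb; reflexivity.
  - exists (sub1_pred n (pvar n 0)); split; [constructor|].
    intros A; rewrite app_comp; rewrite <- (app_idsub A) at 2; f_equal.
    apply subst_eq;
      cbn [comp up wk idsub sub1_ind sub1_pred sub_ind sub_pred up_ind up_pred].
    + reflexivity.
    + intros m X; rewrite upn_Var, fsubst_Var.
      assert (H : forall p Y, lift (Pred n) (@pvar L p Y)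
                = pvar p (if Nat.eq_dec p n then S Y else Y)) by reflexivity.
      destruct (Nat.eq_dec m n) as [-> |];
        [destruct X as [|X]; cbn [scons]|]; rewrite ?H, psubst_pshift_pvar;
        repeat (destruct (Nat.eq_dec _ _); try easy).
Qed.

(** ** Stability of inclusion and typing under substitution *)

Lemma alls_app (L : language) ks ks' (A : form L) :
  alls (ks ++ ks') A = alls ks (alls ks' A).
Proof. apply fold_right_app. Qed.

Lemma lifts_app (L : language) ks ks' (A : form L) :
  lifts (ks ++ ks') A = lifts ks' (lifts ks A).
Proof. apply fold_left_app. Qed.

Lemma app_alls (L : language) ks (sg : subst L) A :
  app sg (alls ks A) = alls ks (app (ups ks sg) A).
Proof.
  revert sg; induction ks as [| k ks IH]; intros sg; [reflexivity|].
  exact (f_equal (All k) (IH (up k sg))).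
Qed.

Lemma app_lifts (L : language) ks (sg : subst L) A :
  app (ups ks sg) (lifts ks A) = lifts ks (app sg A).
Proof.
  revert sg A; induction ks as [| k ks IH]; intros sg A; [reflexivity|].
  simpl; rewrite IH, app_up_lift; reflexivity.
Qed.

(** Through this, stability under substitution yields stability under lifting. *)
Lemma lifts_subst (L : language) ks :
  exists sg : subst L, forall A, lifts ks A = app sg A.
Proof.
  induction ks as [| k ks [sg H]].
  - exists idsub; intros A; now rewrite app_idsub.
  - exists (comp (wk k) sg); intros A; rewrite <- app_comp, app_wk; apply H.
Qed.

Lemma map_app_lifts (L : language) ks (sg : subst L) (Gamma : context L) :
  map (app (ups ks sg)) (map (lifts ks) Gamma)
  = map (lifts ks) (map (app sg) Gamma).
Proof. rewrite !map_map; apply map_ext; intros A; apply app_lifts. Qed.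

Section Inclusion.

Context {L : language} (E : term L -> term L -> Prop).

Lemma particular_case_sym u v :
  particular_case E u v -> particular_case E v u.
Proof. intros []; now constructor. Qed.

Lemma particular_case_tsubst s u v :
  particular_case E u v -> particular_case E (tsubst s u) (tsubst s v).
Proof. intros []; rewrite !tsubst_comp; now constructor. Qed.

Lemma fincl_instance k io A C :
  instance k io -> fincl E A (All k C) -> fincl E A (app io C).
Proof.
  intros [u | n G] H.
  - rewrite app_sub1_ind; now apply fincl_all_e_ind.
  - rewrite app_sub1_pred; now apply fincl_all_e_pred.
Qed.

(** The quantification over [sg] stays inside the induction because the introduction rule passes to
    [up k sg]. In the elimination rules, [sg] moves past the instantiation at the price of a new
    instance. *)
Lemma fincl_app A B : fincl E A B -> forall sg, fincl E (app sg A) (app sg B).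
Proof.
  induction 1 as [A | k C D | C C' D D' _ IH1 _ IH2 | A C u _ IH
    | A n C G _ IH | A k D _ IH | A D B _ IH1 _ IH2 | A D u v _ IH Huv];
    intros sg.
  - constructor.
  - apply fincl_dist.
  - exact (fincl_imp (IH1 sg) (IH2 sg)).
  - rewrite <- app_sub1_ind.
    destruct (instance_app sg (instance_term u)) as (io & Hio & ->).
    apply (fincl_instance Hio), IH.
  - rewrite <- app_sub1_pred.
    destruct (instance_app sg (instance_form n G)) as (io & Hio & ->).
    apply (fincl_instance Hio), IH.
  - apply fincl_all_i; rewrite <- app_up_lift; apply IH.
  - eapply fincl_tr; eauto.
  - rewrite app_inst_ind; eapply fincl_eq.
    + rewrite <- app_inst_ind; apply IH.
    + now apply particular_case_tsubst.
Qed.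

(** The inclusion of [forall xi A] in [A], with both sides read in the scope of [xi]. Monotonicity
    of the quantifier, which is not a generating rule, follows from it. *)
Lemma fincl_lift_all k (A : form L) : fincl E (lift k (All k A)) A.
Proof.
  destruct (@instance_zero L k) as (io & Hio & HA).
  rewrite <- (HA A) at 2; apply (fincl_instance Hio).
  rewrite <- app_wk; apply fincl_ax.
Qed.

Lemma fincl_all k A B : fincl E A B -> fincl E (All k A) (All k B).
Proof.
  intros H; apply fincl_all_i; exact (fincl_tr (fincl_lift_all k A) H).
Qed.

Lemma fincl_alls ks A B : fincl E A B -> fincl E (alls ks A) (alls ks B).
Proof. intros H; induction ks; simpl; auto using fincl_all. Qed.

Lemma fincl_lifts ks A B : fincl E A B -> fincl E (lifts ks A) (lifts ks B).
Proof.
  intros H; destruct (@lifts_subst L ks) as [sg Hsg]; rewrite !Hsg.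
  now apply fincl_app.
Qed.

Lemma typing_incl Gamma t A B :
  typing E Gamma t A -> fincl E A B -> typing E Gamma t B.
Proof.
  intros [] HAB; econstructor; eauto using fincl_tr.
Qed.

Lemma typing_app_subst Gamma t A :
  typing E Gamma t A ->
  forall sg, typing E (map (app sg) Gamma) t (app sg A).
Proof.
  induction 1 as [Gamma ks x B A Hx HA | Gamma ks u B C A _ IH HA
    | Gamma ks u v B C A _ IHu _ IHv HA]; intros sg;
    apply (fun H => fincl_app H sg) in HA; rewrite app_alls in HA.
  - refine (typing_var _ _ _ _ HA).
    rewrite <- map_app_lifts; now apply map_nth_error.
  - specialize (IH (ups ks sg)); cbn [map] in IH; rewrite map_app_lifts in IH.
    exact (typing_abs _ _ IH HA).
  - specialize (IHu (ups ks sg)); specialize (IHv (ups ks sg)).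
    rewrite map_app_lifts in IHu, IHv.
    exact (typing_app _ _ IHu IHv HA).
Qed.

Lemma typing_lifts ks Gamma t A :
  typing E Gamma t A -> typing E (map (lifts ks) Gamma) t (lifts ks A).
Proof.
  intros H; destruct (@lifts_subst L ks) as [sg Hsg].
  rewrite Hsg, (map_ext _ _ Hsg); now apply typing_app_subst.
Qed.

(** Every typing rule closes its conclusion with a block of quantifiers, so [ks] is absorbed by
    prefixing it to the block of the last rule. *)
Lemma typing_gen ks Gamma t A :
  typing E (map (lifts ks) Gamma) t A -> typing E Gamma t (alls ks A).
Proof.
  assert (Hmap : forall ks', map (lifts ks') (map (lifts ks) Gamma)
                   = map (lifts (ks ++ ks')) Gamma).
  { intros ks'; rewrite map_map; apply map_ext; intros B.
    now rewrite lifts_app. }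
  intros H; inversion H as [? ks' x B ? Hx HA | ? ks' u B C ? Hu HA
    | ? ks' u v B C ? Hu Hv HA]; subst; rewrite Hmap in *;
    apply (fincl_alls ks) in HA; rewrite <- alls_app in HA.
  - exact (typing_var _ _ _ Hx HA).
  - exact (typing_abs _ _ Hu HA).
  - exact (typing_app _ _ Hu Hv HA).
Qed.

Lemma typing_lren Gamma t A :
  typing E Gamma t A ->
  forall Delta r,
    (forall x B, nth_error Gamma x = Some B ->
                 nth_error Delta (r x) = Some B) ->
    typing E Delta (lren r t) A.
Proof.
  assert (Hmap : forall ks (Gamma Delta : context L) r,
    (forall x B, nth_error Gamma x = Some B ->
                 nth_error Delta (r x) = Some B) ->
    forall x B, nth_error (map (lifts ks) Gamma) x = Some B ->
                nth_error (map (lifts ks) Delta) (r x) = Some B).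
  { intros ks Gamma' Delta r Hr x B; rewrite !nth_error_map.
    destruct (nth_error Gamma' x) eqn:Hx; [|easy].
    now rewrite (Hr _ _ Hx). }
  induction 1 as [Gamma ks x B A Hx HA | Gamma ks u B C A _ IH HA
    | Gamma ks u v B C A _ IHu _ IHv HA]; intros Delta r Hr; simpl.
  - exact (typing_var _ _ _ (Hmap ks _ _ _ Hr _ _ Hx) HA).
  - refine (typing_abs _ _ _ HA); apply IH; intros [|x] D; simpl; auto.
    apply Hmap, Hr.
  - refine (typing_app _ _ _ _ HA); eauto.
Qed.

Lemma typing_lsubst Gamma t A :
  typing E Gamma t A ->
  forall Delta s,
    (forall x B, nth_error Gamma x = Some B -> typing E Delta (s x) B) ->
    typing E Delta (lsubst s t) A.
Proof.
  assert (Hmap : forall ks (Gamma Delta : context L) s,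
    (forall x B, nth_error Gamma x = Some B -> typing E Delta (s x) B) ->
    forall x B, nth_error (map (lifts ks) Gamma) x = Some B ->
                typing E (map (lifts ks) Delta) (s x) B).
  { intros ks Gamma' Delta s Hs x B; rewrite nth_error_map.
    destruct (nth_error Gamma' x) eqn:Hx; [|easy].
    intros [= <-]; apply typing_lifts; auto. }
  induction 1 as [Gamma ks x B A Hx HA | Gamma ks u B C A _ IH HA
    | Gamma ks u v B C A _ IHu _ IHv HA]; intros Delta s Hs; simpl.
  (* The variable rule generalized the type of [x] over [ks]; [typing_gen] does the same for the
     arbitrary term put in its place. *)
  - apply typing_incl with (2 := HA), typing_gen; eauto.
  - refine (typing_abs _ _ _ HA); apply IH; intros [|x] D; simpl.
    + intros [= <-]; apply (typing_var _ [] 0) with (B := B); [reflexivity|].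
      apply fincl_ax.
    + intros Hx; apply (Hmap _ _ _ _ Hs) in Hx.
      apply (typing_lren Hx); auto.
  - refine (typing_app _ _ _ _ HA); eauto.
Qed.

(** ** Inversion of inclusion *)

(** Rule (e) acts at one variable, whose index moves when quantifiers are crossed. Letting [j] be
    arbitrary makes the relation stable under [up_ind]. *)
Definition replaces (s s' : nat -> term L) : Prop :=
  exists j, particular_case E (s j) (s' j) /\ forall i, i <> j -> s i = s' i.

Lemma replaces_sym s s' : replaces s s' -> replaces s' s.
Proof.
  intros (j & Hj & H); exists j; split; [now apply particular_case_sym|].
  intros i Hi; symmetry; auto.
Qed.

Lemma replaces_up_ind k s s' :
  replaces s s' -> replaces (up_ind k s) (up_ind k s').
Proof.
  intros (j & Hj & H); destruct k; [|now exists j].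
  exists (S j); split; simpl; [now apply particular_case_tsubst|].
  intros [|i] Hi; simpl; [reflexivity|]; rewrite H; auto.
Qed.

Lemma fincl_replaces s s' B :
  replaces s s' -> fincl E (fsubst s B) (fsubst s' B).
Proof.
  intros (j & Hj & H).
  (* [D] applies [s] everywhere except at [j], which becomes the variable 0. Both sides are then
     instances of [D], as rule (e) requires. *)
  set (D := fsubst (fun i => if Nat.eq_dec i j then Var 0
                             else tsubst tshift (s i)) B).
  assert (HD : forall s0, (forall i, i <> j -> s i = s0 i) ->
                 fsubst s0 B = inst_ind D (s0 j)).
  { intros s0 H0; unfold D, inst_ind; rewrite fsubst_comp; f_equal.
    extensionality i; destruct (Nat.eq_dec i j) as [-> | Hi];
      simpl; [reflexivity|].
    rewrite tsubst_comp, <- H0 by exact Hi; symmetry; apply tsubst_Var. }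
  rewrite (HD s), (HD s') by auto.
  eapply fincl_eq; [apply fincl_ax | exact Hj].
Qed.

Definition up_inds (ks : list sort) (s : nat -> term L) : nat -> term L :=
  fold_left (fun s k => up_ind k s) ks s.

Lemma replaces_up_inds ks s s' :
  replaces s s' -> replaces (up_inds ks s) (up_inds ks s').
Proof.
  revert s s'; induction ks as [| k ks IH]; intros s s' H; simpl; auto.
  apply IH; now apply replaces_up_ind.
Qed.

Lemma fsubst_alls ks s (A : form L) :
  fsubst s (alls ks A) = alls ks (fsubst (up_inds ks s) A).
Proof.
  revert s; induction ks as [| k ks IH]; intros s; simpl; [reflexivity|].
  f_equal; apply IH.
Qed.

(** An individual substitution alters only the terms inside atomic formulas, so the quantifiers and
    the arrow are already present in [D]. *)
Lemma fsubst_alls_imp ks s (D B C : form L) :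
  fsubst s D = alls ks (Imp B C) ->
  exists B0 C0, D = alls ks (Imp B0 C0)
    /\ B = fsubst (up_inds ks s) B0 /\ C = fsubst (up_inds ks s) C0.
Proof.
  revert s D; induction ks as [| k ks IH]; intros s D H;
    destruct D as [| | | B0 C0 | k' D]; try discriminate; simpl in H.
  - injection H as <- <-; exists B0, C0; auto.
  - injection H as -> H; destruct (IH _ _ H) as (B0 & C0 & -> & HB & HC).
    exists B0, C0; auto.
Qed.

(** [sg] instantiates the variables [ks] of [A] in the scope extended by [ks']
    and [zs]; the equation on lifted formulas says that it fixes all the others.
    The extra variables [zs] come from [fincl_dist]. *)
Definition arrow_incl (A A' : form L) : Prop :=
  forall ks B C, A = alls ks (Imp B C) ->
  exists ks' B' C' zs sg,
    A' = alls ks' (Imp B' C')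
    /\ (forall D, app sg (lifts ks D) = lifts zs (lifts ks' D))
    /\ fincl E (lifts zs B') (app sg B)
    /\ fincl E (alls zs (app sg C)) C'.

Lemma arrow_incl_refl A : arrow_incl A A.
Proof.
  intros ks B C ->; exists ks, B, C, [], idsub; repeat split; simpl;
    intros; rewrite app_idsub; constructor.
Qed.

Lemma arrow_incl_trans A A' A'' :
  arrow_incl A A' -> arrow_incl A' A'' -> arrow_incl A A''.
Proof.
  intros H1 H2 ks B C HA.
  destruct (H1 _ _ _ HA) as (ks1 & B1 & C1 & zs1 & sg1 & HA1 & HD1 & HB1 & HC1).
  destruct (H2 _ _ _ HA1) as (ks2 & B2 & C2 & zs2 & sg2 & -> & HD2 & HB2 & HC2).
  (* The result of [sg1] lives below [zs1], so [sg2] has to act there as [ups zs1 sg2]. The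
     variables [zs2] it adds therefore come outside [zs1]. *)
  exists ks2, B2, C2, (zs2 ++ zs1), (comp sg1 (ups zs1 sg2)).
  repeat split.
  - intros D; rewrite <- app_comp, HD1, app_lifts, HD2, lifts_app; reflexivity.
  - rewrite <- app_comp, lifts_app.
    apply fincl_tr with (lifts zs1 (app sg2 B1)); [now apply fincl_lifts|].
    rewrite <- app_lifts; now apply fincl_app.
  - rewrite <- app_comp, alls_app, <- app_alls.
    apply fincl_tr with (2 := HC2), fincl_alls; now apply fincl_app.
Qed.

Lemma arrow_incl_instance k io C :
  instance k io -> arrow_incl (All k C) (app io C).
Proof.
  intros Hio [|k' ks] B D; [discriminate|]; intros [= <- ->].
  rewrite app_alls.
  exists ks, (app (ups ks io) B), (app (ups ks io) D), [], (ups ks io).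
  repeat split; try apply fincl_ax.
  intros A; simpl; rewrite app_lifts, (instance_lift _ Hio); reflexivity.
Qed.

Lemma fincl_arrow_incl A A' : fincl E A A' -> arrow_incl A A'.
Proof.
  induction 1 as [A | k C D | C C' D D' HC _ HD _ | A C u _ IH
    | A n C G _ IH | A k D _ IH | A D B _ IH1 _ IH2 | A D u v _ IH Huv].
  - apply arrow_incl_refl.
  - intros [|k' [|k'' ks]] B C'; try discriminate; intros [= <- -> ->].
    (* The variable distributed over the arrow survives as the fresh variable in [zs]: the domain is
       instantiated at it and the codomain is generalized over it. *)
    exists [], (All k B), (All k C'), [k], idsub.
    repeat split; simpl; intros; rewrite app_idsub; try constructor.
    apply fincl_lift_all.
  - intros [|k ks] B F; [|discriminate]; intros [= -> ->].
    exists [], C', D', [], idsub; repeat split; simpl; intros;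
      rewrite ?app_idsub; auto.
  - rewrite <- app_sub1_ind; apply (arrow_incl_trans IH).
    apply arrow_incl_instance; constructor.
  - rewrite <- app_sub1_pred; apply (arrow_incl_trans IH).
    apply arrow_incl_instance; constructor.
  - intros ks B C ->; rewrite <- app_wk, app_alls in IH.
    destruct (IH _ _ _ eq_refl)
      as (ks' & B' & C' & zs & sg & -> & HD & HB & HC).
    (* The induction hypothesis concerns the lifted formula, so its substitution is preceded by the
       weakening, pushed below [ks]. *)
    exists (k :: ks'), B', C', zs, (comp (ups ks (wk k)) sg).
    repeat split; rewrite <- ?app_comp; auto.
    intros D; rewrite <- app_comp, app_lifts, HD, app_wk; reflexivity.
  - exact (arrow_incl_trans IH1 IH2).
  - apply (arrow_incl_trans IH); clear A IH.
    (* The arrow is already in [D], so no variable needs instantiating and the identity substitution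
       suffices. Passing from [u] to [v] is left to the two inclusions, reversed on the domain. *)
    intros ks B C H; apply fsubst_alls_imp in H as (B0 & C0 & -> & -> & ->).
    assert (Hr : replaces (up_inds ks (scons u Var))
                   (up_inds ks (scons v Var))).
    { apply replaces_up_inds; exists 0; split; [exact Huv|].
      intros [|i] Hi; [easy | reflexivity]. }
    unfold inst_ind; rewrite fsubst_alls.
    do 2 eexists; eexists; exists [], idsub; repeat split; simpl; intros;
      rewrite app_idsub.
    + reflexivity.
    + now apply fincl_replaces, replaces_sym.
    + now apply fincl_replaces.
Qed.

(** * Inversion of abstractions and subject reduction *)

Lemma typing_abs_inv Gamma t B C :
  typing E Gamma (LAbs t) (Imp B C) ->
  exists zs B' C', fincl E (lifts zs B) B'
    /\ typing E (B' :: map (lifts zs) Gamma) t C'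
    /\ fincl E (alls zs C') C.
Proof.
  intros H; inversion H as [| ? ks ? B0 C0 ? Ht HA |]; subst.
  destruct (fincl_arrow_incl HA _ _ _ eq_refl)
    (* The target is an arrow, so [ks'] is empty and [HD] says that [sg] turns the context lifted by
       [ks] into the one lifted by [zs]. *)
    as ([|k ks'] & B' & C' & zs & sg & HBC & HD & HB & HC); [|discriminate].
  injection HBC as <- <-.
  exists zs, (app sg B0), (app sg C0); repeat split; auto.
  apply (fun H => typing_app_subst H sg) in Ht; simpl in Ht.
  rewrite map_map in Ht; rewrite (map_ext _ _ HD) in Ht; exact Ht.
Qed.

Lemma typing_beta1 t t' :
  beta1 t t' -> forall Gamma A, typing E Gamma t A -> typing E Gamma t' A.
Proof.
  induction 1 as [t u | t t' u _ IH | t u u' _ IH | t t' _ IH];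
    intros Gamma A H; inversion H as [| ? ks ? B C ? Ht HA
      | ? ks ? ? B C ? Ht Hu HA]; subst.
  - apply typing_abs_inv in Ht as (zs & B' & C' & HB & Ht & HC).
    (* Two generalizations are undone in turn: over the [ks] of the application rule, then over the
       [zs] of the inversion. What remains is typed in the scope of both. *)
    apply typing_incl with (2 := HA), typing_gen.
    apply typing_incl with (2 := HC), typing_gen.
    apply (typing_lsubst Ht); intros [|x] D; simpl.
    + intros [= <-]; apply typing_incl with (2 := HB).
      now apply typing_lifts.
    + intros Hx; apply (typing_var _ [] x) with (B := D); [|apply fincl_ax].
      rewrite (map_ext _ (fun A => A)) by reflexivity; now rewrite map_id.
  - exact (typing_app _ _ (IH _ _ Ht) Hu HA).
  - exact (typing_app _ _ Ht (IH _ _ Hu) HA).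
  - exact (typing_abs _ _ (IH _ _ Ht) HA).
Qed.

End Inclusion.

Theorem theorem5 (L : language) (E : term L -> term L -> Prop)
    (Gamma : context L) (t t' : lam) (A : form L) :
  typing E Gamma t A -> beta t t' -> typing E Gamma t' A.
Proof.
  intros H Hb; revert H; induction Hb; eauto using typing_beta1.
Qed.
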